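(* Let $\mathcal{A}$ be a unital algebra over $\mathbb{C}$ with a linear functional $\varphi:\mathcal{A}\to\mathbb{C}$ such that $\varphi(1)=1$. Let $x,y\in\mathcal{A}$ be free random variables such that $\varphi(x)=0$, $\varphi(x^2)\neq 0$ and $\varphi(y)\neq 0$. Denote by $S_x$ and $\tilde S_x$ the two $S$-transforms of $x$ (formal series in $\sqrt z$), and by $S_y$ the $S$-transform of $y$ (a formal power series in $z$). Then $$S_{xy}(z)=S_x(z)\cdot S_y(z)\qquad\text{and}\qquad \tilde S_{xy}(z)=\tilde S_x(z)\cdot S_y(z)$$ are the two $S$-transforms of $xy$.
   Context: A random variable is an element of $\mathcal{A}$. Two random variables $x,y\in\mathcal{A}$ are free if the unital subalgebras $\mathcal{A}_1,\mathcal{A}_2$ generated by $x$ and by $y$ respectively are free with respect to $\varphi$: $\varphi(a_1a_2\cdots a_n)=0$ whenever $n\ge 1$, $a_j\in\mathcal{A}_{i(j)}$ with $i(j)\in\{1,2\}$, $i(j)\neq i(j+1)$ for $1\le j<n$, and $\varphi(a_j)=0$ for all $j$. For a random variable $a$, let $\psi_a(z)=\sum_{n=1}^\infty \varphi(a^n)z^n$, a formal power series in $z$. $S$-transform, non-vanishing mean: if $\varphi(a)\neq 0$, let $\chi$ be the inverse under composition of $\psi_a$ (a formal power series in $z$ without constant term). The $S$-transform of $a$ is $S_a(z)=\chi(z)\cdot\frac{1+z}{z}$, a formal power series in $z$. $S$-transforms, vanishing mean: if $\varphi(a)=0$ and $\varphi(a^2)\neq 0$, then $\psi_a(z)=\varphi(a^2)z^2+\varphi(a^3)z^3+\cdots$,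 and there are exactly two formal power series in $\sqrt z$ without constant term, $\chi(z)=\sum_{k\ge1}\beta_k z^{k/2}$ and $\tilde\chi(z)=\sum_{k\ge1}\tilde\beta_k z^{k/2}$, satisfying $\psi_a(\chi(z))=z$ and $\psi_a(\tilde\chi(z))=z$. The two $S$-transforms of $a$ are $$S_a(z)=\chi(z)\cdot\frac{1+z}{z},\qquad \tilde S_a(z)=\tilde\chi(z)\cdot\frac{1+z}{z},$$ both formal series in $\sqrt z$ of the form $\gamma_{-1}\frac{1}{\sqrt z}+\sum_{k=0}^\infty\gamma_k z^{k/2}$. Which of the two is called $S_a$ and which $\tilde S_a$ is an arbitrary choice. For $x,y$ as in the claim one has $\varphi(xy)=0$ and $\varphi((xy)^2)=\varphi(x^2)\varphi(y)^2\neq0$, so the two $S$-transforms of $xy$ are defined by the vanishing-mean definition. All identities are identities of formal series. *)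

(* Defs.v *)
From mathcomp Require Import all_boot all_order all_algebra.
From mathcomp Require Import classical_sets fsbigop.

Set Implicit Arguments.
Unset Strict Implicit.
Unset Printing Implicit Defensive.

Import Order.TTheory GRing.Theory Num.Theory.
Local Open Scope ring_scope.

Section FormalSeries.
Variable K : fieldType.

(* Formal power series in one indeterminate u, given by their coefficients.
   The indeterminate is not part of the type: u is z for series in z, and
   u = sqrt z (so that z = u ^ 2) for series in sqrt z. *)
Definition fps := nat -> K.

Definition fps_Xn (m : nat) : fps := fun k => (k == m)%:R.

Definition fps_mul (f g : fps) : fps :=
  fun k => \sum_(i < k.+1) f i * g (k - i)%N.

Definition fps_exp (f : fps) (n : nat) : fps := iter n (fps_mul f) (fps_Xn 0).

(* f(g(u)) = \sum_n f_n g(u)^n. Only meaningful when g 0 = 0: then g^n has no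
   term of degree < n, so the terms with n > k do not contribute to the
   coefficient of u^k. *)
Definition fps_comp (f g : fps) : fps :=
  fun k => \sum_(n < k.+1) f n * fps_exp g n k.

(* Formal Laurent series in u: only finitely many negative exponents. *)
Record laurent := Laurent {
  lcoef :> int -> K;
  lcoefP : exists N : int, forall k : int, k < N -> lcoef k = 0
}.

(* The sum has finite support, both factors being bounded below. *)
Definition lmul_coef (f g : laurent) : int -> K :=
  fun k => \sum_(i \in [set: int]%classic) f i * g (k - i).

Lemma lmul_coefP (f g : laurent) :
  exists N : int, forall k : int, k < N -> lmul_coef f g k = 0.
Proof.
have [M fM] := lcoefP f; have [N gN] := lcoefP g.
exists (M + N) => k kMN; apply: fsbig1 => i _.
have [iM|Mi] := ltP i M; first by rewrite fM ?mul0r.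
by rewrite gN ?mulr0// ltrBlDl (lt_le_trans kMN)// lerD2r.
Qed.

Definition lmul (f g : laurent) : laurent := Laurent (lmul_coefP f g).

Definition lfps_coef (f : fps) : int -> K :=
  fun k => if k is Posz n then f n else 0.

Lemma lfps_coefP (f : fps) :
  exists N : int, forall k : int, k < N -> lfps_coef f k = 0.
Proof. by exists 0 => -[]. Qed.

Definition lfps (f : fps) : laurent := Laurent (lfps_coefP f).

(* (1 + z) / z = z^-1 + 1 as a Laurent series in u, where z = u ^ m. *)
Definition onez_coef (m : nat) : int -> K :=
  fun k => (k == - m%:Z)%:R + (k == 0)%:R.

Lemma onez_coefP (m : nat) :
  exists N : int, forall k : int, k < N -> onez_coef m k = 0.
Proof.
exists (- m%:Z) => k km; have k0 : k < 0.
  by rewrite (lt_le_trans km)// oppr_le0.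
by rewrite /onez_coef (lt_eqF km) (lt_eqF k0) addr0.
Qed.

Definition onez_over_z (m : nat) : laurent := Laurent (onez_coefP m).

(* f(z) as a series in u = sqrt z *)
Definition in_sqrt (f : fps) : laurent := lfps (fps_comp f (fps_Xn 2)).

End FormalSeries.

Section FreeProbability.
Variables (K : fieldType) (A : algType K) (phi : {scalar A}).

(* a belongs to the unital subalgebra generated by x *)
Definition gen_subalg (x a : A) : Prop :=
  forall B : {pred A}, GRing.subalg_closed B -> x \in B -> a \in B.

(* i j tells which of the two algebras the factor a j comes from. *)
Definition free_rv (x y : A) : Prop :=
  forall (n : nat) (a : nat -> A) (i : nat -> bool),
    (0 < n)%N ->
    (forall j, (j < n)%N -> gen_subalg (if i j then y else x) (a j)) ->
    (forall j, (j.+1 < n)%N -> i j != i j.+1) ->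
    (forall j, (j < n)%N -> phi (a j) = 0) ->
    phi (\prod_(j < n) a j) = 0.

Definition psi (a : A) : fps K :=
  fun n => if n is 0%N then 0 else phi (a ^+ n).

(* S is a series in z *)
Definition is_S_transform (a : A) (S : fps K) : Prop :=
  phi a != 0 /\
  exists chi : fps K,
    [/\ chi 0%N = 0,
        fps_comp (psi a) chi = fps_Xn K 1,
        fps_comp chi (psi a) = fps_Xn K 1 &
        lfps S = lmul (lfps chi) (onez_over_z K 1)].

(* S is a Laurent series in u = sqrt z, so z is u ^ 2 *)
Definition is_S_transform0 (a : A) (S : laurent K) : Prop :=
  [/\ phi a = 0, phi (a ^+ 2) != 0 &
  exists chi : fps K,
    [/\ chi 0%N = 0,
        fps_comp (psi a) chi = fps_Xn K 2 &
        S = lmul (lfps chi) (onez_over_z K 2)]].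

Definition the_two_S_transforms (a : A) (S S' : laurent K) : Prop :=
  S <> S' /\ forall T : laurent K, is_S_transform0 a T <-> T = S \/ T = S'.

End FreeProbability.

(* Main.v *)
(* Let t = z = u^2, a = chi_x(u), b = chi_y(t) = t * be, and consider in A[[u]]
   X = (1 - a x)^-1 and Y = (1 - b y)^-1, which both have mean 1 + t. For the
   centred series P = X - (1 + t) and Q = (Y - (1 + t)) / t one checks
     (1 - a x) ((1 + t) - P Q) (1 - b y) = 1 - c x y,   c = a * be * (1 + t),
   so that (1 - c x y)^-1 = Y ((1 + t) - P Q)^-1 X. Expanding the inverse along
   the powers of P Q, freeness kills all terms but the first one, which leaves
   the mean 1 + t, i.e. psi_xy(c) = t. The two choices of chi_x give two
   distinct solutions c, and the equation has at most two because its solutions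
   are determined by their coefficient of u, whose square is prescribed. *)

Require Import Defs.
From HB Require Import structures.
From mathcomp Require Import all_boot all_order all_algebra.
From mathcomp Require Import boolp classical_sets functions fsbigop reals.
From mathcomp.real_closed Require Import complex.

Set Implicit Arguments.
Unset Strict Implicit.
Unset Printing Implicit Defensive.

Import Order.TTheory GRing.Theory Num.Theory.
Local Open Scope ring_scope.

(** * The ring of formal power series *)

(* A copy of [fps] over an arbitrary ring: the convolution product goes on this
   alias because [nat -> R] itself canonically carries the pointwise one. *)
Definition series (R : Type) := nat -> R.

Section SeriesRing.
Variable R : nzRingType.
Implicit Types f g h : series R.

HB.instance Definition _ := GRing.Zmodule.copy (series R) (nat -> R).

Lemma coefs_add f g k : (f + g) k = f k + g k. Proof. by []. Qed.
Lemma coefs_sub f g k : (f - g) k = f k - g k. Proof. by []. Qed.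

Definition series_one : series R := fun k => (k == 0%N)%:R.

Definition series_mul f g : series R :=
  fun k => \sum_(i < k.+1) f i * g (k - i)%N.

(** The coefficient of index k sees only coefficients of index at most k, so truncating both factors
    to polynomials loses nothing. Associativity of the product is inherited from polynomials this
    way. *)
Lemma series_mul_poly f g N k : (k < N)%N ->
  series_mul f g k = (\poly_(i < N) f i * \poly_(i < N) g i)`_k.
Proof.
move=> kN; rewrite coefM; apply: eq_bigr => i _.
by rewrite !coef_poly (leq_ltn_trans (leq_subr _ _) kN)
  (leq_trans (ltn_ord i) kN).
Qed.

Lemma series_mulA : associative series_mul.
Proof.
move=> f g h; apply/funext => k.
transitivity ((\poly_(i < k.+1) f i *
  (\poly_(i < k.+1) g i * \poly_(i < k.+1) h i))`_k).
  rewrite coefM; apply: eq_bigr => i _.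
  by rewrite coef_poly ltn_ord (@series_mul_poly _ _ k.+1) ?ltnS ?leq_subr.
rewrite mulrA coefM; apply: eq_bigr => i _.
by rewrite (@series_mul_poly _ _ k.+1)// coef_poly ltnS leq_subr.
Qed.

Lemma series_mul1 : left_id series_one series_mul.
Proof.
move=> f; apply/funext => k; rewrite /series_mul big_ord_recl /= mul1r subn0.
by rewrite big1 ?addr0// => i _; rewrite mul0r.
Qed.

Lemma series_mulr1 : right_id series_one series_mul.
Proof.
move=> f; apply/funext => k.
rewrite /series_mul big_ord_recr /= /series_one subnn mulr1.
rewrite big1 ?add0r// => i _.
by rewrite subn_eq0 leqNgt ltn_ord mulr0.
Qed.

Lemma series_mulDl : left_distributive series_mul +%R.
Proof.
move=> f g h; apply/funext => k; rewrite coefs_add -big_split /=.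
by apply: eq_bigr => i _; rewrite coefs_add mulrDl.
Qed.

Lemma series_mulDr : right_distributive series_mul +%R.
Proof.
move=> f g h; apply/funext => k; rewrite coefs_add -big_split /=.
by apply: eq_bigr => i _; rewrite coefs_add mulrDr.
Qed.

Lemma series_one_neq0 : series_one != 0.
Proof.
by apply/eqP => /(congr1 (fun f => f 0%N)) /eqP;
  rewrite /series_one /= oner_eq0.
Qed.

HB.instance Definition _ := GRing.Zmodule_isNzRing.Build (series R)
  series_mulA series_mul1 series_mulr1 series_mulDl series_mulDr
    series_one_neq0.

Lemma coefs_mul f g k : (f * g) k = \sum_(i < k.+1) f i * g (k - i)%N.
Proof. by []. Qed.

Lemma coefs_mul_rev f g k : (f * g) k = \sum_(i < k.+1) f (k - i)%N * g i.
Proof.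
rewrite coefs_mul (reindex_inj rev_ord_inj) /=; apply: eq_bigr => i _.
by rewrite subSS subKn// -ltnS.
Qed.

Lemma coefs_mul0 f g : (f * g) 0%N = f 0%N * g 0%N.
Proof. by rewrite coefs_mul big_ord1. Qed.

Lemma coefs_one k : (1 : series R) k = (k == 0%N)%:R.
Proof. by []. Qed.

Lemma coefs_sum (I : Type) (r : seq I) (P : pred I) (F : I -> series R) k :
  (\sum_(i <- r | P i) F i) k = \sum_(i <- r | P i) F i k.
Proof. by elim/big_rec2: _ => // i y1 y2 _ <-. Qed.

Lemma eq_coefs_mull f g g' k :
  (forall i, (i <= k)%N -> g i = g' i) -> (f * g) k = (f * g') k.
Proof.
move=> gg'; rewrite !coefs_mul; apply: eq_bigr => i _.
by rewrite gg'// leq_subr.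
Qed.

Lemma eq_coefs_mulr f f' g k :
  (forall i, (i <= k)%N -> f i = f' i) -> (f * g) k = (f' * g) k.
Proof.
move=> ff'; rewrite !coefs_mul; apply: eq_bigr => i _.
by rewrite ff'// -ltnS.
Qed.

Lemma coefs_exp_lt f n k : f 0%N = 0 -> (k < n)%N -> (f ^+ n) k = 0.
Proof.
move=> f0; elim: n k => // n IH k kn; rewrite exprS coefs_mul.
apply: big1 => -[[|i] ik] _ /=; first by rewrite f0 mul0r.
by rewrite IH ?mulr0// ltn_subLR// addSn (leq_trans kn)// ltnS leq_addl.
Qed.

(* Only meaningful when f 0 = 0: otherwise the powers f^n with n > k contribute
   to the coefficient of index k as well. *)
Definition geom f : series R := fun k => \sum_(n < k.+1) (f ^+ n) k.

Lemma geom_low f N k : f 0%N = 0 -> (k < N)%N ->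
  geom f k = (\sum_(n < N) f ^+ n) k.
Proof.
move=> f0 kN; rewrite coefs_sum /geom (big_ord_widen N (fun n => (f ^+ n) k))//.
rewrite big_mkcond; apply: eq_bigr => i _; case: ifPn => //.
by rewrite -leqNgt => ki; rewrite coefs_exp_lt.
Qed.

(** Up to index k, [geom f] agrees with a finite geometric sum, which telescopes to 1 - f^(k+1); the
    last power has no term of degree k or less. *)
Lemma mul_geom f : f 0%N = 0 -> (1 - f) * geom f = 1.
Proof.
move=> f0; apply/funext => k.
rewrite (@eq_coefs_mull _ _ (\sum_(n < k.+1) f ^+ n)); last first.
  by move=> i ik; apply: geom_low.
by rewrite -[1 - f]opprB mulNr -subrX1 opprB coefs_sub coefs_exp_lt ?subr0.
Qed.

Lemma geom_mul f : f 0%N = 0 -> geom f * (1 - f) = 1.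
Proof.
move=> f0; apply/funext => k.
rewrite (@eq_coefs_mulr _ (\sum_(n < k.+1) f ^+ n)); last first.
  by move=> i ik; apply: geom_low.
(* The telescoping identity has 1 - f on the left; in a noncommutative ring the finite sum still
   commutes with it, being a sum of powers of f. *)
rewrite (_ : _ * (1 - f) = (1 - f) * (\sum_(n < k.+1) f ^+ n)); last first.
  symmetry; apply: commr_sum => i _.
  by apply/commr_sym/commrB; [apply: commr1|apply/commr_sym/commrX].
by rewrite -[1 - f]opprB mulNr -subrX1 opprB coefs_sub coefs_exp_lt ?subr0.
Qed.

(** A coefficient of a product is a sum of products of one coefficient from each factor. The
    predicate [G] varies in the induction, so that the coefficient taken from the last factor can be
    absorbed into it. *)
Lemma coefs_prod_ind (G : R -> Prop) (n : nat) (p : nat -> series R) :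
    G 0 -> (forall u v, G u -> G v -> G (u + v)) ->
    (forall s : nat -> nat, G (\prod_(j < n) p j (s j))) ->
  forall k, G ((\prod_(j < n) p j) k).
Proof.
elim: n G => [|n IH] G G0 GD Gp k.
  rewrite big_ord0; case: k => [|k]; last by rewrite coefs_one.
  by have := Gp id; rewrite big_ord0.
rewrite big_ord_recr /= coefs_mul; apply: big_ind => // i _.
apply: (IH (fun v => G (v * p n (k - i)%N))) => [|u v Gu Gv|s].
- by rewrite mul0r.
- by rewrite mulrDl; apply: GD.
have := Gp (fun j => if (j < n)%N then s j else (k - i)%N).
rewrite big_ord_recr /= ltnn; congr (G (_ * _)).
by apply: eq_bigr => j _; rewrite ltn_ord.
Qed.

End SeriesRing.

Section SeriesComRing.
Variable R : comNzRingType.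

Lemma series_mulC : commutative (@series_mul R).
Proof.
move=> f g; apply/funext => k; apply/esym.
by rewrite -[LHS]/((g * f : series R) k) coefs_mul_rev; apply: eq_bigr => i _;
  rewrite mulrC.
Qed.

HB.instance Definition _ :=
  GRing.PzRing_hasCommutativeMul.Build (series R) series_mulC.

End SeriesComRing.

(** * Scalar series, which are central, and constant series *)

Section Scalars.
Variables (K : comNzRingType) (A : algType K).
Implicit Types f : series K.

Definition scal f : series A := fun k => (f k)%:A.

Lemma scal_is_zmod_morphism : zmod_morphism scal.
Proof. by move=> f g; apply/funext => k; rewrite /scal coefs_sub scalerBl. Qed.

HB.instance Definition _ := GRing.isZmodMorphism.Build _ _ scal
  scal_is_zmod_morphism.

Lemma scal_is_monoid_morphism : monoid_morphism scal.
Proof.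
split=> [|f g]; apply/funext => k; rewrite /scal.
  by rewrite !coefs_one; case: (k == _); rewrite ?scale1r ?scale0r.
rewrite !coefs_mul scaler_suml; apply: eq_bigr => i _.
by rewrite -scalerAl mul1r scalerA.
Qed.

HB.instance Definition _ := GRing.isMonoidMorphism.Build _ _ scal
  scal_is_monoid_morphism.

Lemma scalC f (g : series A) : scal f * g = g * scal f.
Proof.
apply/funext => k; rewrite coefs_mul_rev coefs_mul; apply: eq_bigr => i _.
by rewrite /scal -scalerAl -scalerAr mul1r mulr1.
Qed.

End Scalars.

Section Constants.
Variable R : nzRingType.

Definition cseries (x : R) : series R := fun k => if k is 0%N then x else 0.

Lemma cseries_mul x y : cseries (x * y) = cseries x * cseries y.
Proof.
apply/funext => -[|k]; first by rewrite coefs_mul0.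
rewrite coefs_mul big1// => -[[|i] ik] _ /=; last by rewrite mul0r.
by rewrite mulr0.
Qed.

Lemma cseries_exp x n : cseries (x ^+ n) = cseries x ^+ n.
Proof.
elim: n => [|n IH]; first by apply/funext => -[].
by rewrite !exprS cseries_mul IH.
Qed.

Lemma coefs_mul_cseries (f : series R) x k : (f * cseries x) k = f k * x.
Proof.
rewrite coefs_mul_rev big_ord_recl subn0 big1 ?addr0// => i _ /=.
by rewrite mulr0.
Qed.

End Constants.

(** * Composition of series, the substitution of u^2 for u, and uniqueness of solutions *)

Section Composition.
Variable K : fieldType.
Implicit Types c d f g h : series K.

Lemma fps_expE f n : fps_exp f n = f ^+ n.
Proof.
elim: n => // n IH; rewrite exprS -IH; exact: erefl.
Qed.

Lemma fps_comp_low f g N k : g 0%N = 0 -> (k < N)%N ->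
  fps_comp f g k = \sum_(n < N) f n * (g ^+ n) k.
Proof.
move=> g0 kN; rewrite /fps_comp.
rewrite (big_ord_widen N (fun n => f n * (fps_exp g n) k))// big_mkcond.
apply: eq_bigr => i _; rewrite fps_expE; case: ifPn => //.
by rewrite -leqNgt => ki; rewrite coefs_exp_lt ?mulr0.
Qed.

Lemma coefs_Xn_mul m f k :
  ((fps_Xn K m : series K) * f) k = if (k < m)%N then 0 else f (k - m)%N.
Proof.
rewrite coefs_mul; case: ltnP => [km|mk].
  apply: big1 => i _; rewrite /fps_Xn ltn_eqF ?mul0r//.
  by rewrite (leq_ltn_trans _ km)// -ltnS.
rewrite (bigD1 (Ordinal (mk : (m < k.+1)%N)))//= /fps_Xn eqxx mul1r.
rewrite big1 ?addr0// => i /eqP im.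
case: eqP => [im'|]; last by rewrite mul0r.
by case: im; apply: val_inj.
Qed.

Lemma fps_Xn_lreg m : GRing.lreg (fps_Xn K m : series K).
Proof.
move=> f g /= fg; apply/funext => k.
have /(congr1 (fun h => h (k + m)%N)) := fg.
by rewrite !coefs_Xn_mul ltnNge leq_addl/= addnK.
Qed.

Lemma fps_Xn_exp m n : (fps_Xn K m : series K) ^+ n = fps_Xn K (m * n).
Proof.
elim: n => [|n IH]; first by rewrite muln0.
rewrite exprS IH; apply/funext => k; rewrite coefs_Xn_mul /fps_Xn mulnS.
case: ltnP => km; first by rewrite ltn_eqF// (leq_trans km)// leq_addr.
by rewrite -{2}(subnKC km) eqn_add2l.
Qed.

Lemma fps_comp_X2 f k :
  fps_comp f (fps_Xn K 2) k = if odd k then 0 else f k./2.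
Proof.
rewrite /fps_comp; under eq_bigr do rewrite fps_expE fps_Xn_exp /fps_Xn.
have [ok|ek] := boolP (odd k).
  apply: big1 => i _; rewrite (_ : (_ == _) = false) ?mulr0//.
  by apply: contraTF ok => /eqP ->; rewrite oddM.
have k2 : (k = 2 * k./2)%N by rewrite mul2n halfK (negbTE ek) subn0.
have kk : (k./2 < k.+1)%N.
  by rewrite ltnS leq_half_double -addnn -addnS leq_addr.
rewrite (bigD1 (Ordinal kk))//= -k2 eqxx mulr1 big1 ?addr0// => i /eqP ik.
case: eqP => [kE|]; last by rewrite mulr0.
case: ik; apply: val_inj => /=; apply/eqP.
by rewrite -(eqn_pmul2l (isT : (0 < 2)%N)) -kE -k2.
Qed.

(** The passage from z to u = sqrt z before embedding into Laurent series: [in_sqrt f] is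
    [lfps (dbl f)]. *)
Definition dbl f : series K := fps_comp f (fps_Xn K 2).

Lemma dbl_one : dbl 1 = 1.
Proof. by apply/funext => -[|[|k]]; rewrite /dbl fps_comp_X2//; case: ifP. Qed.

Lemma dbl_add f g : dbl (f + g) = dbl f + dbl g.
Proof.
apply/funext => k; rewrite coefs_add /dbl !fps_comp_X2 coefs_add.
by case: ifP; rewrite ?addr0.
Qed.

Lemma sum_even (F : nat -> K) m :
  \sum_(i < m.*2.+1) (if odd i then 0 else F i./2) = \sum_(i < m.+1) F i.
Proof.
elim: m => [|m IH]; first by rewrite !big_ord1.
rewrite doubleS big_ord_recr big_ord_recr /= IH odd_double/= addr0.
by rewrite doubleK [RHS]big_ord_recr.
Qed.

Lemma dbl_mul f g : dbl (f * g) = dbl f * dbl g.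
Proof.
apply/funext => k; rewrite /dbl fps_comp_X2 !coefs_mul.
under [RHS]eq_bigr do rewrite !fps_comp_X2.
have [ok|/negbTE ek] := ifPn.
  rewrite big1// => i _; rewrite oddB -1?ltnS// ok.
  by case: (odd i); rewrite ?mul0r ?mulr0.
rewrite -(sum_even (fun i => f i * g (k./2 - i)%N)).
have kk : k./2.*2 = k by rewrite halfK ek subn0.
rewrite kk; apply: eq_bigr => i _; case: ifPn => oi; first by rewrite mul0r.
have ->: ((k - i)./2 = k./2 - i./2)%N.
  by rewrite -{1}kk -{1}(even_halfK oi) -doubleB doubleK.
by rewrite oddB -1?ltnS// ek (negbTE oi).
Qed.

Lemma dbl_exp f n : dbl (f ^+ n) = dbl f ^+ n.
Proof. by elim: n => [|n IH]; rewrite ?dbl_one// !exprS dbl_mul IH. Qed.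

Lemma dbl_Xn m : dbl (fps_Xn K m) = fps_Xn K m.*2.
Proof.
apply/funext => k; rewrite /dbl fps_comp_X2 /fps_Xn.
have [ok|ek] := boolP (odd k).
  rewrite (_ : (k == _) = false)//.
  by apply: contraTF ok => /eqP ->; rewrite odd_double.
by rewrite -[in RHS](even_halfK ek) (inj_eq double_inj).
Qed.

(** Holds because [dbl] commutes with powers. It carries the equation satisfied by the inverse of
    psi_y from z to u. *)
Lemma dbl_comp f g : g 0%N = 0 -> dbl (fps_comp f g) = fps_comp f (dbl g).
Proof.
move=> g0; apply/funext => k.
have dg0 : dbl g 0%N = 0 by rewrite /dbl fps_comp_X2.
rewrite (fps_comp_low f dg0 (ltnSn k)) {1}/dbl fps_comp_X2.
under eq_bigr do rewrite -dbl_exp /dbl fps_comp_X2.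
case: ifPn => ok; first by rewrite big1// => i _; rewrite mulr0.
by rewrite (fps_comp_low _ g0 (_ : (k./2 < k.+1)%N))// ltnS leq_half_double
  -addnn -addnS leq_addr.
Qed.

Lemma fps_factor_X2 f : f 0%N = 0 -> f 1%N = 0 ->
  f = (fps_Xn K 2 : series K) * (fun k => f k.+2).
Proof.
move=> f0 f1; apply/funext => -[|[|k]]; rewrite coefs_Xn_mul//=.
by rewrite subSS subSS subn0.
Qed.

(** After division by its constant term, f becomes 1 - g with g without constant term, and a
    geometric series inverts it. *)
Lemma fps_inv f : f 0%N != 0 -> exists e : series K, e * f = 1.
Proof.
move=> f0; pose g : series K := 1 - cseries (f 0%N)^-1 * f.
exists (geom g * cseries (f 0%N)^-1); rewrite -mulrA.
have -> : cseries (f 0%N)^-1 * f = 1 - g by rewrite opprB addrC subrK.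
by apply: geom_mul; rewrite /g coefs_sub coefs_mul0 /= mulVf// subrr.
Qed.

Lemma coefs_mul_lt f g i j : (forall k, (k < i)%N -> f k = 0) ->
  (forall k, (k < j)%N -> g k = 0) -> forall k, (k < i + j)%N -> (f * g) k = 0.
Proof.
move=> fi gj k kij; rewrite coefs_mul big1// => l _.
have [/fi ->|il] := ltnP l i; first by rewrite mul0r.
have lk : (l <= k)%N by rewrite -ltnS.
by rewrite gj ?mulr0// ltn_subLR// (leq_trans kij)// leq_add2r.
Qed.

(* c^n - d^n = (c - d) * (...), where the cofactor has order >= 2 for n >= 3:
   at the first index m with c m <> d m only n = 2 contributes to the
   coefficient of index m + 1. *)
Lemma fps_comp_inj_order2 f c d : f 1%N = 0 -> c 0%N = 0 -> d 0%N = 0 ->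
  f 2%N * (c 1%N + d 1%N) != 0 -> fps_comp f c = fps_comp f d -> c = d.
Proof.
move=> f1 c0 d0 ne0 fcd; apply/funext => k; apply/eqP/contraT => cdk.
have [m cdm mmin] := ex_minnP (ex_intro (fun m => c m != d m) k cdk).
have ltm j : (j < m)%N -> (c - d) j = 0.
  by apply: contraTeq; rewrite coefs_sub subr_eq0 -leqNgt; apply: mmin.
have /(congr1 (fun h => h m.+1)) := fcd.
rewrite (fps_comp_low f c0 (ltnSn _)) (fps_comp_low f d0 (ltnSn _)).
move/eqP; rewrite -subr_eq0 -sumrB; under eq_bigr do rewrite -mulrBr.
have low (n : nat) : (2 < n)%N -> (c ^+ n) m.+1 - (d ^+ n) m.+1 = 0.
  case: n => // n n1; rewrite -coefs_sub subrXX.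
  apply: (@coefs_mul_lt _ _ m 2) => //; last by rewrite addn2.
  move=> j j2; rewrite coefs_sum big1// => i _.
  apply: (@coefs_mul_lt _ _ (n - i) i).
  - by move=> l; apply: coefs_exp_lt.
  - by move=> l; apply: coefs_exp_lt.
  - have ni : (i <= n)%N by rewrite -ltnS.
    by rewrite subnK// (leq_trans j2).
have m0 : (0 < m)%N by case: m cdm {mmin ltm low} => //; rewrite c0 d0 eqxx.
rewrite (bigD1 (Ordinal (m0 : (2 < m.+2)%N))) //= big1 ?addr0; last first.
  move=> -[[|[|[|i]]] im] // _; rewrite -?[val _]/(_.+3)/=.
  - by rewrite !expr0 subrr mulr0.
  - by rewrite f1 mul0r.
  - by rewrite low ?mulr0.
(* In (c - d)(c + d) at index m + 1, the top term carries the zero constant term of c + d and the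
   terms below m vanish, leaving (c - d)_m (c + d)_1. *)
rewrite -coefs_sub subr_sqr coefs_mul big_ord_recr /= subnn big_ord_recr /=.
rewrite big1 => [|i _]; last by rewrite ltm ?mul0r.
rewrite subSnn add0r coefs_sub (coefs_add c d 0) c0 d0 addr0 mulr0 addr0.
by rewrite mulrCA mulf_eq0 (negbTE ne0) orbF subr_eq0 (negbTE cdm).
Qed.

End Composition.

(** * Means of series over a free pair *)

Section GeneratedSubalgebra.
Variables (K : fieldType) (A : algType K) (x : A).

Lemma gen_subalg_id : gen_subalg x x.
Proof. by move=> B. Qed.

Lemma gen_subalg_one : gen_subalg x 1.
Proof. by move=> B []. Qed.

Lemma gen_subalg_zero : gen_subalg x 0.
Proof. by move=> B [B1 BD _] _; rewrite -(addNr 1) -scaleN1r; apply: BD. Qed.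

Lemma gen_subalg_lin (k : K) u v :
  gen_subalg x u -> gen_subalg x v -> gen_subalg x (k *: u + v).
Proof.
by move=> xu xv B Balg Bx; have [_ BD _] := Balg; apply: BD;
  [apply: xu|apply: xv].
Qed.

Lemma gen_subalg_add u v :
  gen_subalg x u -> gen_subalg x v -> gen_subalg x (u + v).
Proof. by move=> xu xv; rewrite -[u]scale1r; apply: gen_subalg_lin. Qed.

Lemma gen_subalg_scale (k : K) u : gen_subalg x u -> gen_subalg x (k *: u).
Proof.
move=> xu; rewrite -[k *: u]addr0; apply: gen_subalg_lin => //.
exact gen_subalg_zero.
Qed.

Lemma gen_subalg_mul u v :
  gen_subalg x u -> gen_subalg x v -> gen_subalg x (u * v).
Proof.
by move=> xu xv B Balg Bx; have [_ _ BM] := Balg; apply: BM;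
  [apply: xu|apply: xv].
Qed.

Definition over_gen (F : series A) := forall k, gen_subalg x (F k).

Lemma over_gen_mul F G : over_gen F -> over_gen G -> over_gen (F * G).
Proof.
move=> xF xG k; rewrite coefs_mul; apply: big_ind => [||i _].
- exact gen_subalg_zero.
- exact gen_subalg_add.
- exact (gen_subalg_mul (xF _) (xG _)).
Qed.

Lemma over_gen_scal (f : series K) : over_gen (scal A f).
Proof. by move=> k; apply/gen_subalg_scale/gen_subalg_one. Qed.

Lemma over_gen_cseries : over_gen (cseries x).
Proof. by case=> [|k]; [exact gen_subalg_id|exact gen_subalg_zero]. Qed.

Lemma over_gen_sub F G : over_gen F -> over_gen G -> over_gen (F - G).
Proof.
move=> xF xG k; rewrite coefs_sub -scaleN1r addrC.
by apply: gen_subalg_lin.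
Qed.

Lemma over_gen_exp F n : over_gen F -> over_gen (F ^+ n).
Proof.
move=> xF; elim: n => [|n IH]; last by rewrite exprS; apply: over_gen_mul.
by rewrite expr0 -(rmorph1 (scal A)); apply: over_gen_scal.
Qed.

Lemma over_gen_geom F : over_gen F -> over_gen (geom F).
Proof.
move=> xF k; rewrite /geom; apply: big_ind => [||i _].
- exact gen_subalg_zero.
- exact gen_subalg_add.
- exact: over_gen_exp.
Qed.

End GeneratedSubalgebra.

(** * Means of series and the effect of freeness on alternating products *)

Section Functional.
Variables (K : fieldType) (A : algType K) (phi : {scalar A}).

(** The extension of [phi] to series that is linear over scalar series, see [mean_scal]. *)
Definition mean (F : series A) : series K := fun k => phi (F k).

Lemma meanD F G : mean (F + G) = mean F + mean G.
Proof. by apply/funext => k; rewrite coefs_add /mean coefs_add raddfD. Qed.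

Lemma meanB F G : mean (F - G) = mean F - mean G.
Proof. by apply/funext => k; rewrite coefs_sub /mean coefs_sub raddfB. Qed.

Lemma mean_scal f F : mean (scal A f * F) = f * mean F.
Proof.
apply/funext => k; rewrite /mean !coefs_mul raddf_sum; apply: eq_bigr => i _.
by rewrite /scal -scalerAl mul1r; exact: scalarZ.
Qed.

Hypothesis phi1 : phi 1 = 1.

Lemma mean_one : mean 1 = 1.
Proof. by apply/funext => -[|k]; rewrite /mean !coefs_one/= ?raddf0. Qed.

Lemma mean_scalE f : mean (scal A f) = f.
Proof. by rewrite -[scal A f]mulr1 mean_scal mean_one mulr1. Qed.

Lemma scal_cseries_exp (f : series K) (x : A) n :
  (scal A f * cseries x) ^+ n = scal A (f ^+ n) * cseries (x ^+ n).
Proof. by rewrite exprMn_comm ?rmorphXn ?cseries_exp//; apply: scalC. Qed.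

(** The resolvent (1 - a x)^-1 expands as the sum of a^n x^n; the summand 1 comes from n = 0, which
    [psi] leaves out. *)
Lemma mean_geom (a : series K) (x : A) : a 0%N = 0 ->
  mean (geom (scal A a * cseries x)) = 1 + (fps_comp (psi phi x) a : series K).
Proof.
move=> a0; apply/funext => k.
rewrite coefs_add (fps_comp_low _ a0 (ltnSn k)) /mean /geom raddf_sum.
rewrite !big_ord_recl /= mul0r add0r expr0.
congr (_ + _); first by rewrite -/(mean 1 k) mean_one.
apply: eq_bigr => i _; rewrite scal_cseries_exp coefs_mul_cseries /scal.
by rewrite -scalerAl mul1r mulrC; exact: scalarZ.
Qed.

Lemma coefs_mean_geom (F G D : series A) k : D 0%N = 0 ->
  mean (F * geom D * G) k = \sum_(n < k.+1) mean (F * D ^+ n * G) k.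
Proof.
move=> D0; rewrite /mean -raddf_sum; congr (phi _).
transitivity ((\sum_(n < k.+1) F * D ^+ n * G) k); last by rewrite coefs_sum.
rewrite -mulr_suml -mulr_sumr.
apply: eq_coefs_mulr => i ik; apply: eq_coefs_mull => j ji.
by apply: geom_low => //; rewrite ltnS (leq_trans ji).
Qed.

Variables x y : A.
Hypothesis xy_free : free_rv phi x y.

(** Freeness applies coefficientwise: every coefficient of the product is a sum of alternating
    products of centred elements. *)
Lemma mean_free_prod n (p : nat -> series A) (i : nat -> bool) : (0 < n)%N ->
  (forall j, (j < n)%N -> over_gen (if i j then y else x) (p j)) ->
  (forall j, (j.+1 < n)%N -> i j != i j.+1) ->
  (forall j, (j < n)%N -> mean (p j) = 0) ->
  mean (\prod_(j < n) p j) = 0.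
Proof.
move=> n0 pi ii p0; apply/funext => k.
apply: (coefs_prod_ind (G := fun v => phi v = 0)) => [|u v pu pv|s].
- exact: raddf0.
- by rewrite raddfD /= pu pv addr0.
apply: (@xy_free n (fun j => p j (s j)) i n0 _ ii _) => j jn; first exact: pi.
by have /(congr1 (fun f => f (s j))) := p0 _ jn.
Qed.

Section Alternating.
Variables P Q : series A.
Hypothesis (xP : over_gen x P) (yQ : over_gen y Q).
Hypothesis (P0 : mean P = 0) (Q0 : mean Q = 0).

(** The alternating word of n letters that starts with Q when b is true and with P otherwise. *)
Definition alt (b : bool) n : series A := \prod_(j < n) (if odd j (+) b then Q
  else P).

Lemma mean_alt b n : (0 < n)%N -> mean (alt b n) = 0.
Proof.
move=> n0; apply: (@mean_free_prod n (fun j => if odd j (+) b then Q else P)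
  (fun j => odd j (+) b)) => // j _; try by case: (odd j (+) b).
by rewrite oddS; case: (odd j); case: b.
Qed.

Lemma exp_alt n : (P * Q) ^+ n = alt false n.*2.
Proof.
elim: n => [|n IH]; first by rewrite /alt big_ord0.
by rewrite exprSr IH doubleS /alt !big_ord_recr /= odd_double mulrA.
Qed.

Lemma altSr b n : odd n = b -> alt b n * P = alt b n.+1.
Proof. by move=> nb; rewrite /alt big_ord_recr /= nb addbb. Qed.

Lemma altSl n : Q * alt false n = alt true n.+1.
Proof.
rewrite /alt big_ord_recl /=; congr (_ * _); apply: eq_bigr => j _.
by rewrite /= addbF addbT negbK.
Qed.

(** Expansion gives multiples of the alternating words (PQ)^n, (PQ)^n P, Q (PQ)^n and Q (PQ)^n P.
    Only the empty word, at n = 0, has nonzero mean. The outer factors are the resolvents Y and X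
    written through Q and P. *)
Lemma mean_alternating (s t : series K) n :
  mean ((scal A s + scal A t * Q) * (P * Q) ^+ n * (scal A s + P)) =
  if n is 0%N then s * s else 0.
Proof.
set W := (P * Q) ^+ n.
have W0 : mean W = (n == 0%N)%:R.
  rewrite /W; case: n {W} => [|n]; first exact: mean_one.
  by rewrite exp_alt mean_alt.
have -> : (scal A s + scal A t * Q) * W * (scal A s + P) =
  scal A (s * s) * W + scal A s * (W * P) + scal A (s * t) * (Q * W)
  + scal A t * (Q * W * P).
  rewrite mulrDr !mulrDl -[_ * W * scal A s]scalC -[_ * Q * W * scal A s]scalC.
  by rewrite ![scal A (_ * _)]rmorphM /= !mulrA addrACA addrA.
rewrite !meanD !mean_scal W0 /W exp_alt altSl !altSr /= ?odd_double//.
rewrite !mean_alt// !mulr0 !addr0.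
by case: n {W W0} => [|n]; rewrite ?mulr1 ?mulr0.
Qed.

End Alternating.

End Functional.

(** * Factorization of the resolvent of xy and multiplicativity *)

(** With s = 1 + t, u = 1 - U, v = 1 - tV, the left side is s u v - (1 - s u)(sV - 1), and v + (sV -
    1) = V collapses it. P and Q enter through relations free of inverses and of division by t. *)
Lemma resolvent_factorization (E : nzRingType) (t U V P Q : E) :
    (forall z, t * z = z * t) ->
    (1 - U) * P = 1 - (1 + t) * (1 - U) -> Q * (1 - t * V) = (1 + t) * V - 1 ->
  (1 - U) * (1 + t - P * Q) * (1 - t * V) = 1 - (1 + t) * U * V.
Proof.
move=> tC uP Qv; set s := 1 + t; set u := 1 - U; set v := 1 - t * V.
rewrite -/s -/u -/v in uP Qv.
have sC z : s * z = z * s by rewrite /s mulrDl mulrDr mul1r mulr1 tC.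
have vE : v + (s * V - 1) = V.
  by rewrite /v /s mulrDl mul1r -[_ - 1]addrA -[_ * V - 1]opprB addrCA subrr
    addr0.
have uV : u * V = V - U * V by rewrite /u mulrBl mul1r.
clearbody u v s.
have -> : u * (s - P * Q) * v = s * u * v - (1 - s * u) * (s * V - 1).
  by rewrite -uP -Qv mulrBr mulrBl sC !mulrA.
rewrite mulrBl mul1r opprB addrA -mulrDr vE -!mulrA uV mulrBr.
by rewrite opprB addrC addrA subrK.
Qed.

Section Multiplicativity.
Variables (K : fieldType) (A : algType K) (phi : {scalar A}) (x y : A).

(** Here [be] stands for b / t, so that b is [t * be] and no quotient is formed; regularity of t
    replaces division by it. *)
Lemma psi_mul_free (a be t : series K) :
    phi 1 = 1 -> free_rv phi x y -> a 0%N = 0 -> t 0%N = 0 -> GRing.lreg t ->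
    fps_comp (psi phi x) a = t -> fps_comp (psi phi y) (t * be) = t ->
  fps_comp (psi phi (x * y)) (a * (be * (1 + t))) = t.
Proof.
move=> phi1 xy_free a0 t0 t_reg xa ybe.
pose s := 1 + t.
pose U := scal A a * cseries x; pose V := scal A be * cseries y.
pose C := scal A (a * (be * s)) * cseries (x * y).
have tV : scal A t * V = scal A (t * be) * cseries y by rewrite rmorphM mulrA.
have U0 : U 0%N = 0 by rewrite /U coefs_mul0 /scal a0 scale0r mul0r.
have tV0 : (scal A t * V) 0%N = 0 by rewrite coefs_mul0 /scal t0 scale0r mul0r.
have C0 : C 0%N = 0.
  by rewrite /C coefs_mul0 /scal coefs_mul0 a0 mul0r scale0r mul0r.
have CE : C = scal A s * U * V.
  rewrite /C /U /V cseries_mul mulrA [a * be * s]mulrC !rmorphM /= -!mulrA.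
  by rewrite [cseries x * (scal A be * _)]mulrA -scalC -mulrA.
pose X := geom U; pose Y := geom (scal A t * V).
(* Since (1 - tV) Y = 1, one has Y - 1 = t V Y, hence Y - s = t (V Y - 1): this Q is (Y - s) / t. *)
pose P := X - scal A s; pose Q := V * Y - 1.
have sE : scal A s = 1 + scal A t by rewrite rmorphD rmorph1.
have meanX : mean phi X = s by rewrite /X /U mean_geom// xa.
have meanY : mean phi Y = s.
  by rewrite /Y tV mean_geom ?coefs_mul0 ?t0 ?mul0r// ybe.
have YE : Y = scal A s + scal A t * Q.
  rewrite sE /Q mulrBr mulr1 mulrA addrACA subrr addr0 -{1}(mul_geom tV0).
  by rewrite mulrBl mul1r subrK.
have P0 : mean phi P = 0 by rewrite meanB meanX mean_scalE// subrr.
have Q0 : mean phi Q = 0.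
  apply: t_reg; rewrite /= mulr0 -mean_scal.
  have -> : scal A t * Q = Y - scal A s by rewrite YE addrC addKr.
  by rewrite meanB meanY mean_scalE// subrr.
have xP : over_gen x P.
  apply: over_gen_sub; last exact: over_gen_scal.
  by apply/over_gen_geom/over_gen_mul;
    [exact: over_gen_scal|exact: over_gen_cseries].
have yV : over_gen y V.
  by apply/over_gen_mul; [exact: over_gen_scal|exact: over_gen_cseries].
have yQ : over_gen y Q.
  apply: over_gen_sub; last by rewrite -(rmorph1 (scal A));
    exact: over_gen_scal.
  by apply/over_gen_mul => //; apply/over_gen_geom/over_gen_mul => //;
    exact: over_gen_scal.
have fact : (1 - U) * (scal A s - P * Q) * (1 - scal A t * V) = 1 - C.
  rewrite CE sE; apply: resolvent_factorization => [z||].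
  - exact: scalC.
  - by rewrite -sE mulrBr mul_geom// -scalC.
  - by rewrite mulrBl mul1r -mulrA geom_mul// mulr1 mulrDl mul1r opprB addrA.
have [|eps epsE] := @fps_inv K s;
  first by rewrite /s coefs_add coefs_one t0 addr0 oner_neq0.
(* As [eps] inverts s, the middle factor s - PQ is s (1 - D). The constant term of P is 1 - 1 = 0,
   so 1 - D is inverted by [geom D]. *)
pose D := scal A eps * (P * Q).
have D0 : D 0%N = 0.
  have Pz : P 0%N = 0.
    rewrite /P coefs_sub /X /geom big_ord1 expr0 /scal /s coefs_add t0 addr0.
    by rewrite scale1r subrr.
  by rewrite /D !coefs_mul0 Pz mul0r mulr0.
pose W := scal A eps * geom D.
have MW : (scal A s - P * Q) * W = 1.
  have sD : scal A s * D = P * Q.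
    by rewrite /D mulrA -rmorphM mulrC epsE rmorph1 mul1r.
  rewrite -sD -{1}[scal A s]mulr1 -mulrBr /W mulrA -(scalC eps) -!mulrA.
  by rewrite mul_geom// mulr1 -rmorphM epsE rmorph1.
have CW : (1 - C) * (Y * W * X) = 1.
  have inv3 (u m v p q r : series A) :
      v * p = 1 -> m * q = 1 -> u * r = 1 -> u * m * v * (p * q * r) = 1.
    by move=> vp mq ur; rewrite -!mulrA (mulrA v) vp mul1r (mulrA m) mq mul1r.
  by rewrite -fact; apply: inv3 => //; apply: mul_geom.
(* [geom C] is a left inverse of 1 - C, hence equal to the right inverse just found. *)
have geomC : geom C = Y * W * X.
  by rewrite -[LHS]mulr1 -CW mulrA geom_mul// mul1r.
have XE : X = scal A s + P by rewrite /P addrC subrK.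
have meanDX n F G :
    mean phi (F * D ^+ n * G) = eps ^+ n * mean phi (F * (P * Q) ^+ n * G).
  rewrite -mean_scal /D exprMn_comm; last exact: scalC.
  by rewrite -rmorphXn !mulrA -(scalC _ F).
have YDX : mean phi (Y * geom D * X) = s * s.
  apply/funext => k; rewrite coefs_mean_geom// big_ord_recl big1 => [|n _].
    by rewrite addr0 meanDX expr0 mul1r YE XE (mean_alternating phi1 xy_free xP
      yQ P0 Q0).
  by rewrite meanDX YE XE (mean_alternating phi1 xy_free xP yQ P0 Q0) mulr0.
(* The mean is eps s s = s, and it also equals 1 + psi_xy(c); cancelling 1 gives t. *)
have : mean phi (geom C) = s.
  rewrite geomC /W mulrA -(scalC eps Y) -!mulrA mean_scal mulrA YDX mulrA.
  by rewrite epsE mul1r.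
rewrite mean_geom//; first exact: addrI.
by rewrite coefs_mul0 a0 mul0r.
Qed.

End Multiplicativity.

(** * Laurent series *)

Section Laurent.
Variable K : fieldType.
Implicit Types (f g : series K) (S T : laurent K).

Lemma laurent_eq S T : lcoef S =1 lcoef T -> S = T.
Proof.
case: S T => S SP [T TP] /= /funext ST; subst T.
by rewrite (Prop_irrelevance SP TP).
Qed.

Lemma lmulE S T (r : seq int) k : uniq r ->
  (forall i, i \notin r -> S i * T (k - i) = 0) ->
  lmul S T k = \sum_(i <- r) S i * T (k - i).
Proof.
move=> ru r0; rewrite [LHS]/= /lmul_coef.
rewrite (fsbigE r)// => [|i _]; last exact: r0.
by apply: eq_bigl => i; rewrite in_setT.
Qed.

Lemma lfps_coef_neg f (k : int) : k < 0 -> lfps_coef f k = 0.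
Proof. by case: k. Qed.

(** Only the indices k + m and k contribute to the convolution. This reads (1 + z) / z as
    multiplication by 1 + u^m followed by a shift by m. *)
Lemma lmul_onez f m k : (0 < m)%N ->
  lmul (lfps f) (onez_over_z K m) k =
  lfps_coef ((1 + (fps_Xn K m : series K)) * f) (k + m%:Z).
Proof.
move=> m0; have neq : k + m%:Z != k.
  by rewrite -subr_eq0 addrAC subrr add0r eqz_nat -lt0n.
rewrite (@lmulE _ _ [:: k + m%:Z; k]); last 2 first.
- by rewrite /= inE neq.
- move=> i; rewrite !inE negb_or => /andP[/negbTE im /negbTE ik].
  have kim : (k - i == - m%:Z) = false.
    by rewrite subr_eq addrC -subr_eq opprK eq_sym.
  by rewrite /= /onez_coef kim subr_eq0 [k == i]eq_sym ik addr0 mulr0.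
rewrite !big_cons big_nil addr0 /= /onez_coef opprD addrA subrr add0r eqxx.
rewrite oppr_eq0 eqz_nat (gtn_eqF m0) addr0 mulr1 eqxx.
rewrite [0 == _]eq_sym oppr_eq0 eqz_nat (gtn_eqF m0) add0r mulr1.
case kmE : (k + m%:Z) => [n|n] /=.
  rewrite mulrDl mul1r coefs_add coefs_Xn_mul; congr (_ + _).
  have -> : k = n%:Z - m%:Z by rewrite -kmE addrK.
  case: ltnP => nm; last by rewrite subzn.
  by rewrite lfps_coef_neg// subr_lt0 ltz_nat.
rewrite lfps_coef_neg ?addr0//; apply: (@le_lt_trans _ _ (k + m%:Z)).
  by rewrite lerDl.
by rewrite kmE.
Qed.

Lemma lmul_lfps S f g m k :
  (forall k, S k = lfps_coef f (k + m%:Z)) ->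
  lmul S (lfps g) k = lfps_coef (f * g) (k + m%:Z).
Proof.
move=> SE; have kE i : k - i = (k + m%:Z) - (i + m%:Z).
  by rewrite opprD addrACA subrr addr0.
(* If k + m is negative, then for each i one of i + m and k - i is negative. Otherwise only i = j -
   m with j between 0 and n can contribute. *)
case kmE : (k + m%:Z) => [n|n]; last first.
  rewrite /= /lmul_coef fsbig1// => i _; rewrite SE kE kmE /=.
  have [i0|i0] := ltP (i + m%:Z) 0; first by rewrite lfps_coef_neg ?mul0r.
  by rewrite [X in _ * X]lfps_coef_neg ?mulr0// subr_lt0 (lt_le_trans _ i0).
have inj : injective (fun j : nat => j%:Z - m%:Z).
  by move=> i j /addIr [].
rewrite (@lmulE _ _ [seq j%:Z - m%:Z | j <- iota 0 n.+1]); last 2 first.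
- by rewrite map_inj_uniq ?iota_uniq.
- move=> i ir; rewrite SE kE kmE /=.
  case imE : (i + m%:Z) => [j|j]; last by rewrite mul0r.
  rewrite [X in _ * X]lfps_coef_neg ?mulr0// subr_lt0 ltz_nat ltnNge.
  apply: contra ir => jn; apply/mapP; exists j; first by rewrite mem_iota.
  by rewrite -imE addrK.
rewrite big_map -[iota 0 n.+1]/(index_iota 0 n.+1) big_mkord /= coefs_mul.
apply: eq_bigr => j _; rewrite SE kE kmE subrK subzn//.
by rewrite -ltnS.
Qed.

(** Lets S_y be absorbed into chi_x, so that the product S_x S_y takes the form of an
    S-transform. *)
Lemma lmul_onez_lfps f g m : (0 < m)%N ->
  lmul (lmul (lfps f) (onez_over_z K m)) (lfps g) =
  lmul (lfps (f * g : series K)) (onez_over_z K m).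
Proof.
move=> m0; apply: laurent_eq => k.
rewrite lmul_onez// mulrA.
by rewrite -(lmul_lfps _ _ (fun k => lmul_onez f k m0)).
Qed.

Lemma lmul_onez_inj f g m : (0 < m)%N ->
  lmul (lfps f) (onez_over_z K m) = lmul (lfps g) (onez_over_z K m) -> f = g.
Proof.
move=> m0 fg.
have [|e eE] := @fps_inv K (1 + (fps_Xn K m : series K)).
  by rewrite coefs_add coefs_one eqxx /fps_Xn ltn_eqF// addr0 oner_neq0.
rewrite -[f]mul1r -[g]mul1r -eE -!mulrA; congr (_ * _).
apply/funext => n; have /(congr1 (fun S : laurent K => S (n%:Z - m%:Z))) := fg.
by rewrite !lmul_onez// subrK.
Qed.

End Laurent.

(** * There are at most two solutions of psi_z(c) = u^2 *)

Section TwoTransforms.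
Variables (K : fieldType) (A : algType K) (phi : {scalar A}).

(** In degree 2 only the quadratic term of psi_z contributes. Besides prescribing the square of the
    first coefficient of c, this shows that [phi (z ^+ 2)] is nonzero. *)
Lemma psi_comp_coef2 (z : A) (c : series K) : c 0%N = 0 -> phi z = 0 ->
  fps_comp (psi phi z) c = fps_Xn K 2 -> phi (z ^+ 2) * c 1%N ^+ 2 = 1.
Proof.
have c2 : c 0%N = 0 -> (c ^+ 2) 2%N = c 1%N ^+ 2.
  move=> c0; rewrite expr2 coefs_mul !big_ord_recr big_ord0 /= c0.
  by rewrite mul0r mulr0 !add0r addr0.
move=> c0 z0 /(congr1 (fun f => f 2%N)).
rewrite (fps_comp_low _ c0 (ltnSn _)) !big_ord_recr big_ord0 /= expr1 z0 c2//.
by rewrite !mul0r !add0r.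
Qed.

Lemma two_S_transforms (two_neq0 : (2 : K) != 0) (z : A) (c c' : series K) :
    phi z = 0 -> phi (z ^+ 2) != 0 -> c <> c' -> c 0%N = 0 -> c' 0%N = 0 ->
    fps_comp (psi phi z) c = fps_Xn K 2 ->
    fps_comp (psi phi z) c' = fps_Xn K 2 ->
  the_two_S_transforms phi z
    (lmul (lfps c) (onez_over_z K 2)) (lmul (lfps c') (onez_over_z K 2)).
Proof.
move=> z0 zz0 cc' c0 c'0 zc zc'; split=> [/lmul_onez_inj|T];
  first by move=> /(_ isT).
split=> [[_ _ [d [d0 zd ->]]]|[]->]; last 2 first.
- by split=> //; exists c.
- by split=> //; exists c'.
have uniq_sol (e e' : series K) : e 0%N = 0 -> e' 0%N = 0 ->
    fps_comp (psi phi z) e = fps_Xn K 2 ->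
    fps_comp (psi phi z) e' = fps_Xn K 2 -> e <> e' -> e 1%N = - e' 1%N.
  move=> e0 e'0 ze ze' ee'; apply/eqP; rewrite -addr_eq0; apply/contraT => ne0.
  case: ee'; apply: (@fps_comp_inj_order2 _ (psi phi z)) => //=;
    last by rewrite ze ze'.
  by rewrite mulf_neq0.
have [->|dc] := pselect (d = c :> series K); first by left.
have [->|dc'] := pselect (d = c' :> series K); first by right.
(* Distinct solutions have opposite first coefficients. For three pairwise distinct ones this gives
   c_1 = - c_1, which contradicts phi(z^2) c_1^2 = 1. *)
have c1 : c 1%N = 0.
  have := uniq_sol _ _ d0 c'0 zd zc' dc'; rewrite (uniq_sol _ _ d0 c0 zd zc dc).
  rewrite -(uniq_sol _ _ c0 c'0 zc zc' cc') => /eqP.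
  by rewrite eq_sym -addr_eq0 -mulr2n -mulr_natl mulf_eq0 (negbTE two_neq0) =>
    /eqP.
have /eqP := psi_comp_coef2 c0 z0 zc.
by rewrite c1 expr0n mulr0 eq_sym oner_eq0.
Qed.

End TwoTransforms.

(** * Return from power series to the S-transforms of xy *)

Theorem theorem2p5 (R : realType) (A : algType R[i]) (phi : {scalar A})
    (x y : A) (Sx Sx' : laurent R[i]) (Sy : fps R[i])
    (phi1 : phi 1 = 1) (xy_free : free_rv phi x y)
    (phix : phi x = 0) (phix2 : phi (x ^+ 2) != 0) (phiy : phi y != 0)
    (hSx : the_two_S_transforms phi x Sx Sx')
    (hSy : is_S_transform phi y Sy) :
  the_two_S_transforms phi (x * y)
    (lmul Sx (in_sqrt Sy)) (lmul Sx' (in_sqrt Sy)).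
Proof.
case: hSx => Sxx' hSx; case: hSy => _ [d [d0 yd _ SyE]].
have [_ _ [c [c0 xc SxE]]] := (hSx Sx).2 (or_introl erefl).
have [_ _ [c' [c'0 xc' Sx'E]]] := (hSx Sx').2 (or_intror erefl).
pose t : series R[i] := fps_Xn R[i] 2; pose X1 : series R[i] := fps_Xn R[i] 1.
pose b := dbl d; pose be : series R[i] := fun k => b k.+2.
have bE : b = t * be by apply: fps_factor_X2; rewrite /b /dbl fps_comp_X2.
have yb : fps_comp (psi phi y) (t * be) = t.
  by rewrite -bE -dbl_comp// yd dbl_Xn.
(* The definition of S_y with its denominator cleared; the shift to index k - 1 accounts for 1 /
   z. *)
have Xy : X1 * (Sy : series R[i]) = (1 + X1) * (d : series R[i]).
  apply/funext => k.
  have /(congr1 (fun S : laurent _ => S (k%:Z - 1))) := SyE.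
  rewrite lmul_onez// subrK /= => <-; rewrite coefs_Xn_mul.
  by case: k => [|k] //=; rewrite subn1 -subzn.
have sigE : dbl Sy = be * (1 + t).
  apply: (@fps_Xn_lreg _ 2); rewrite /= -/t mulrA -bE mulrC.
  have tE : t = dbl X1 by rewrite dbl_Xn.
  by rewrite tE -dbl_one -dbl_add mulrC -dbl_mul Xy dbl_mul mulrC.
have d1 : d 1%N != 0.
  have /(congr1 (fun f => f 1%N)) := yd.
  rewrite (fps_comp_low _ d0 (ltnSn _)) !big_ord_recr big_ord0 /= !expr1.
  by apply: contra_eq_neq => ->; rewrite mul0r mulr0 !add0r eq_sym oner_eq0.
(* The constant term of S_y is d_1, nonzero since phi(y) d_1 = 1. The inverse serves to keep the two
   solutions distinct. *)
have [|e eE] := @fps_inv _ (dbl Sy).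
  by rewrite sigE coefs_mul0 coefs_add coefs_one /t /fps_Xn /= addr0 mulr1 /be
    /b /dbl fps_comp_X2.
have solution (f : series R[i]) : f 0%N = 0 -> fps_comp (psi phi x) f = t ->
    fps_comp (psi phi (x * y)) (f * dbl Sy) = t.
  move=> f0 xf; rewrite sigE; apply: psi_mul_free => //.
  exact: fps_Xn_lreg.
have f0 (f : series R[i]) : f 0%N = 0 -> (f * dbl Sy) 0%N = 0.
  by rewrite coefs_mul0 => ->; rewrite mul0r.
have phixy : phi (x * y) = 0.
  (* Freeness for the two centred factors x and y - phi(y); the correction term vanishes because
     phi(x) = 0. *)
  have : phi (x * (y - phi y *: 1)) = 0.
    have := xy_free 2%N (fun j => if j is 0%N then x else y - phi y *: 1)
      (fun j => j != 0%N) isT.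
    rewrite !big_ord_recr big_ord0 /= mul1r;
      apply=> [[|[|j]] // _|[|j] //|[|j] // _].
    - exact: gen_subalg_id.
    - rewrite /= addrC -scaleNr.
      apply: gen_subalg_lin; [exact: gen_subalg_one|exact: gen_subalg_id].
    - by rewrite raddfB /= [phi (_ *: 1)]scalarZ phi1 mulr1 subrr.
  by rewrite mulrBr raddfB /= -scalerAr mulr1 [phi (_ *: x)]scalarZ phix mulr0
    subr0.
(* No second moment is computed: a solution c of psi_xy(c) = u^2 exists, and its first coefficient
   satisfies phi((xy)^2) c_1^2 = 1. *)
have phixy2 : phi ((x * y) ^+ 2) != 0.
  have := psi_comp_coef2 (f0 c c0) phixy (solution c c0 xc).
  by apply: contra_eq_neq => ->; rewrite mul0r eq_sym oner_eq0.
rewrite SxE Sx'E !lmul_onez_lfps//.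
apply: two_S_transforms => //;
  [| | exact: f0 | exact: f0 | exact: solution | exact: solution].
  by rewrite pnatr_eq0.
move=> cc'; apply: Sxx'; rewrite SxE Sx'E; congr (lmul (lfps _) _).
have cE (f : series R[i]) : f = e * (f * dbl Sy) by rewrite mulrCA eE mulr1.
by rewrite (cE c) (cE c') cc'.
Qed.
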